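(* Let $C\ge c/(1-\beta)$, where $c$ and $\beta$ are the constants in the distortion condition (JF) for the tower map $F$. For each integer $n\ge 1$ the normalised conditional operator $\tilde{\mathcal P}_n\varphi = \mathcal P_n\varphi/\|\mathcal P_n\varphi\|_{L^1(\Delta,\nu)}$ admits a fixed point in $\mathcal C_n$.
   Context: MAP. Let $\alpha\in(0,1)$ and let $T:[0,1]\to[0,1]$ be a Pomeau--Manneville map: near $0$, $T(x)=x+c_\alpha x^{1+\alpha}+g(x)$ with $c_\alpha>0$, $g$ of class $C^2$ and $g'(x)=o(x^\alpha)$ as $x\to0$; there is $x_0\in(0,1)$ such that $T$ is one-to-one and onto $(0,1)$ on each of $(0,x_0)$ and $(x_0,1)$; $T$ is $C^2$ on $(x_0,1)$ and on $(\epsilon,x_0)$ for every $\epsilon>0$; and $T'>1$ on $(0,x_0)$ and on $(x_0,1)$. TOWER. Put $\Delta_0=[x_0,1]$, $R(x)=\min\{k>0: T^k(x)\in(x_0,1)\}$ (first return time, defined a.e.), $\Delta_{0,i}=\{x\in\Delta_0: R(x)=i\}$ for $i\ge1$, $\Delta=\{(x,\ell): x\in\Delta_0,\ \ell\in\{0,1,2,\dots\},\ \ell<R(x)\}$, cells $\Delta_{\ell,i}=\Delta_{0,i}\times\{\ell\}$ ($0\le\ell<i$), levels $\Delta_\ell=\bigcup_{i>\ell}\Delta_{\ell,i}$; the base $\Delta_0$ is identified with $\Delta_0\times\{0\}$. The tower map $F:\Delta\to\Delta$ is $F(x,\ell)=(x,\ell+1)$ if $\ell<R(x)-1$ and $F(x,R(x)-1)=(T^{R(x)}(x),0)$;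 each top cell $\Delta_{i-1,i}$ is mapped injectively onto $\Delta_0$ (mod null sets). The measure $\nu$ on $\Delta$ is Lebesgue measure on $\Delta_0$ lifted by upwards translation; it is finite. $JF=d(\nu\circ F)/d\nu$ is the Jacobian. The separation time $s(x,y)$ counts the number of returns to $\Delta_0$ before the orbits of $x$ and $y$ are in different elements of $\{\Delta_{0,i}\}$: for $x,y\in\Delta_0$, $s(x,y)$ is the least $k\ge0$ such that the $k$-th returns to $\Delta_0$ of $x$ and $y$ lie in different $\Delta_{0,i}$, and for $(x,\ell),(y,\ell)$ in the same cell, $s((x,\ell),(y,\ell))=s(x,y)$. It is assumed that $F$ is non-singular and satisfies, for constants $\beta\in(0,1)$ and $c<\infty$, (JF) $\left|\frac{JF(x)}{JF(y)}\right|\le e^{c\,\beta^{s(F(x),F(y))}}$ for $x,y$ in the same cell $\Delta_{\ell,i}$. HOLE AND OPERATORS. For an integer $n\ge1$ let $H_n=\bigcup_{i\ge n+1}\bigcup_{1\le\ell<i}\Delta_{\ell,i}$ be the hole and $H_n^1=\bigcup_{i\ge n+1}\Delta_{0,i}$. The Perron--Frobenius operator is $\mathcal P\varphi(x)=\sum_{y\in F^{-1}x}\varphi(y)/|JF(y)|$ on $L^1(\Delta,\nu)$, and the conditional operator is $\mathcal P_n\varphi=\chi_{\Delta\setminus H_n}\,\mathcal P(\varphi\,\chi_{\Delta\setminus H_n})$. CONES. Two points are comparable if both lie in the same cell $\Delta_{\ell,i}$ or both lie in $\Delta_0$. For a fixed $C>0$, $\mathcal C_*=\{\varphi\in L^1(\Delta,\nu):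 \varphi\ge0,\ \varphi(x)\le\varphi(y)e^{C\beta^{s(x,y)}}\text{ for a.e. comparable }x,y\}$ and $\mathcal C_n=\{\varphi\in\mathcal C_*: \int_{\Delta\setminus H_n}\varphi\,d\nu=1,\ \varphi|_{H_n}=0\}$. *)

(* Defs.v *)
From HB Require Import structures.
From mathcomp Require Import all_boot all_order all_algebra.
From mathcomp Require Import all_classical all_reals all_analysis.
Set Implicit Arguments.
Unset Strict Implicit.
Unset Printing Implicit Defensive.
Import Order.TTheory GRing.Theory Num.Theory.
Import numFieldNormedType.Exports.
Local Open Scope ring_scope.
Local Open Scope classical_set_scope.

Section pomeau_manneville_map.
Context {R : realType}.

(* Meant for open sets [A]. *)
Definition C2_on (A : set R) (f : R -> R) : Prop :=
  forall x, A x -> [/\ derivable f x 1, derivable f^`() x 1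
                     & {for x, continuous f^`(2)}].

(* In [pm_germ] only the values of [g] on [0, delta[ matter; a function that is
   C^2 on [0, delta[ (one-sidedly at 0) has a C^2 extension to ]-delta, delta[,
   so asking for smoothness on the symmetric interval loses nothing.
   The values of [T] at [x0] and [1] are unconstrained. *)
Record pomeau_manneville (alpha x0 : R) (T : R -> R) : Prop := {
  pm_alpha : 0 < alpha < 1 ;
  pm_x0 : 0 < x0 < 1 ;
  pm_maps : set_fun `[0, 1] `[0, 1] T ;
  pm_germ : exists (calpha : R) (g : R -> R) (delta : R),
    [/\ 0 < calpha, 0 < delta, C2_on `]- delta, delta[ g,
        g^`() =o_ ((0 : R)^'+) (fun x => x `^ alpha) &
        forall x, 0 <= x < delta ->
          T x = x + calpha * x `^ (1 + alpha) + g x] ;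
  pm_branch_left : set_bij `]0, x0[ `]0, 1[ T ;
  pm_branch_right : set_bij `]x0, 1[ `]0, 1[ T ;
  pm_C2_left : forall eps, 0 < eps -> C2_on `]eps, x0[ T ;
  pm_C2_right : C2_on `]x0, 1[ T ;
  pm_expanding_left : forall x, 0 < x < x0 -> 1 < T^`() x ;
  pm_expanding_right : forall x, x0 < x < 1 -> 1 < T^`() x }.

End pomeau_manneville_map.

(* The library only declares [counting] on nat to be sigma-finite as a set
   function, not as a measure, hence not as a factor of a product measure. *)
HB.instance Definition _ (R : realType) :=
  Measure_isSigmaFinite.Build _ nat R (@counting nat R)
    (sigma_finite_counting R).

Lemma product_sigma_finite d1 d2 (T1 : measurableType d1)
    (T2 : measurableType d2) (R : realType)
    (m1 : {sigma_finite_measure set T1 -> \bar R})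
    (m2 : {sigma_finite_measure set T2 -> \bar R}) :
  sigma_finite setT (m1 \x m2)%E.
Proof.
have /sigma_finiteP[F [TF ndF Foo]] := sigma_finiteT m1.
have /sigma_finiteP[G [TG ndG Goo]] := sigma_finiteT m2.
exists (fun n => F n `*` G n).
  rewrite -setXTT TF TG predeqE => -[x y]; split.
    move=> [/= [n _ Fnx] [k _ Gky]]; exists (maxn n k) => //; split.
    - by move: x Fnx; exact/subsetPset/ndF/leq_maxl.
    - by move: y Gky; exact/subsetPset/ndG/leq_maxr.
  by move=> [n _ []/= ? ?]; split; exists n.
move=> k; have [? ?] := Foo k; have [? ?] := Goo k.
split; first exact: measurableX.
by rewrite product_measure1E// lte_mul_pinfty// ge0_fin_numE.
Qed.

(* Lebesgue measure on every level.  The tower is a subset [tower T x0] of this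
   product, and all integrals and almost-everywhere statements below are
   relative to it. *)
Definition tower_measure {R : realType} :
    set (measurableTypeR R * nat) -> \bar R :=
  (lebesgue_measure \x counting)%E.
HB.instance Definition _ (R : realType) := Measure.on (@tower_measure R).

HB.instance Definition _ (R : realType) :=
  Measure_isSigmaFinite.Build _ (measurableTypeR R * nat)%type R
    (@tower_measure R)
    (product_sigma_finite (@lebesgue_measure R) (@counting nat R)).

Section tower.
Context {R : realType}.
Variables (T : R -> R) (x0 : R).
Local Notation point := (measurableTypeR R * nat)%type.
Local Notation nu := (@tower_measure R).

Definition returns_at (x : R) (k : nat) : bool :=
  (0 < k)%N && (x0 < iter k T x < 1).

(* The value 0 encodes that the orbit never returns (a null set of points):
   the column over such a point is then empty. *)
Definition return_time (x : R) : nat :=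
  if pselect (exists k, returns_at x k) is left ex then ex_minn ex else 0%N.

Definition return_map (x : R) : R := iter (return_time x) T x.

Definition base : set R := `[x0, 1].

(* Delta_{0,i}, relevant for [1 <= i] only. *)
Definition base_cell (i : nat) : set R :=
  [set x | base x /\ return_time x = i].

Definition tower : set point :=
  [set p | base p.1 /\ (p.2 < return_time p.1)%N].

Definition cell (l i : nat) : set point :=
  [set p | [/\ base_cell i p.1, p.2 = l & (l < i)%N]].

(* The condition is l < return_time x - 1, without truncated subtraction. *)
Definition tower_map (p : point) : point :=
  if (p.2.+1 < return_time p.1)%N then (p.1, p.2.+1)
  else (return_map p.1, 0%N).

(* [None] is infinite separation time. A return outside every [base_cell i],
   i >= 1 (a null set of points) counts as separated. *)
Definition separated_at (x y : R) (k : nat) : bool :=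
  ~~ `[< exists i, [/\ (0 < i)%N, base_cell i (iter k return_map x) &
                       base_cell i (iter k return_map y)] >].

Definition separation_time (p q : point) : option nat :=
  if pselect (exists k, separated_at p.1 q.1 k) is left ex
  then Some (ex_minn ex) else None.

(* beta ^ s(p, q), with beta ^ oo = 0. *)
Definition separation_pow (beta : R) (p q : point) : R :=
  if separation_time p q is Some k then beta ^+ k else 0.

(* Only the direction that makes the Perron-Frobenius operator well defined on
   classes of functions. *)
Definition nonsingular : Prop :=
  forall A : set point, measurable A -> A `<=` tower -> nu A = 0%E ->
    nu (tower `&` tower_map @^-1` A) = 0%E.

(* [JF] is a version of d(nu o F)/dnu; as F is injective (up to null sets) only
   cell by cell, nu o F is a measure only on each cell. Everywhere
   positivity of the version is what makes the quotients JF p / JF q and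
   f q / |JF q| meaningful. *)
Definition is_jacobian (JF : point -> R) : Prop :=
  [/\ measurable_fun tower JF,
      forall p, tower p -> 0 < JF p &
      forall (l i : nat) (A : set point), measurable A -> A `<=` cell l i ->
        nu (tower_map @` A) = (\int[nu]_(p in A) (JF p)%:E)%E].

Definition jacobian_distortion (JF : point -> R) (beta c : R) : Prop :=
  forall (l i : nat) (p q : point), cell l i p -> cell l i q ->
    `| JF p / JF q | <=
      expR (c * separation_pow beta (tower_map p) (tower_map q)).

Definition hole (n : nat) : set point :=
  \bigcup_(i in [set i | (n.+1 <= i)%N])
    \bigcup_(l in [set l | (1 <= l < i)%N]) cell l i.

(* The sum over the (countable) fibre of a signed function is the difference of
   the sums of its positive and negative parts; it is 0 by convention at points
   where one of them diverges. *)
Definition perron_frobenius (JF f : point -> R) (p : point) : R :=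
  let fibre : set point := [set q | tower q /\ tower_map q = p] in
  let w := fun q : point => (f q / `|JF q|)%:E in
  fine (\esum_(q in fibre) (w^\+)%E q - \esum_(q in fibre) (w^\-)%E q)%E.

Definition conditional_operator (JF : point -> R) (n : nat) (f : point -> R)
    (p : point) : R :=
  \1_(tower `\` hole n) p *
    perron_frobenius JF (fun q => f q * \1_(tower `\` hole n) q) p.

Definition L1norm (f : point -> R) : R := \int[nu]_(p in tower) `|f p|.

Definition normalised_operator (JF : point -> R) (n : nat) (f : point -> R)
    (p : point) : R :=
  conditional_operator JF n f p / L1norm (conditional_operator JF n f).

Definition comparable_points (p q : point) : Prop :=
  (exists l i, cell l i p /\ cell l i q) \/
  ((base p.1 /\ p.2 = 0%N) /\ (base q.1 /\ q.2 = 0%N)).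

Definition cone_star (beta C : R) (f : point -> R) : Prop :=
  [/\ nu.-integrable tower (EFin \o f),
      \forall p \ae nu, tower p -> 0 <= f p &
      \forall pq \ae (nu \x nu)%E, comparable_points pq.1 pq.2 ->
        f pq.1 <= f pq.2 * expR (C * separation_pow beta pq.1 pq.2)].

Definition cone (beta C : R) (n : nat) (f : point -> R) : Prop :=
  [/\ cone_star beta C f,
      (\int[nu]_(p in tower `\` hole n) (f p)%:E = 1)%E &
      \forall p \ae nu, hole n p -> f p = 0].

End tower.

(* Main.v *)
Require Import Defs.
From mathcomp Require Import all_boot all_order all_algebra.
From mathcomp Require Import all_classical all_reals all_analysis.
From mathcomp Require Import measurable_realfun zify ring lra.
Set Implicit Arguments.
Unset Strict Implicit.
Unset Printing Implicit Defensive.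
Import Order.TTheory GRing.Theory Num.Theory.
Import numFieldNormedType.Exports.
Local Open Scope ring_scope.
Local Open Scope classical_set_scope.

(** The fixed point is built by hand, without a fixed-point theorem for convex
sets.

Off the hole, the tower map climbs each column of height at most [n] with
Jacobian 1 and then returns to the base.  So the equation [P_n f = f / t] means
that, almost everywhere, [f (x, l) = t ^ l * h x] where [h] is fixed by the
transfer operator on the base
  [h z = \sum_(k < n) t ^ k.+1 * w_k z * h (y_k z)],
where [y_k] is the inverse branch of the return map with return time [k.+1]
and [w_k] is the reciprocal of the Jacobian at the top of that column.  Columns
of height larger than [n] do not contribute, since their upper levels lie in
the hole.  The eigenvalue [1 / t] is unknown and has to be found together with
[h].

After a countable set of orbits is discarded, the [y_k] are defined on all that
remains and they increase the separation time by exactly 1.  Hence the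
inequality [c + beta * C <= C] makes the transfer operator preserve the cone of
functions [g] such that [g x <= g x' * expR (C * beta ^ s(x, x'))]; on this
cone the infimum and the supremum of a function are within the factor
[K := expR C] of each other.  Let [u_k t] be the [k]-th iterate of the constant
function 1.  Up to the factor [K] the sequence [u_k t] is both submultiplicative
and supermultiplicative in [k], so it is bounded by [K] as soon as it is
bounded at all, and it is bounded as soon as one term is at most [K^-1]
somewhere.  As [u_k t] is continuous in [t], the supremum [t] of the parameters
with bounded iterates is critical: [K^-1 <= u_k t <= K] for all [k]
([exists_critical_parameter]).

For this [t] the upper limit [v] of [u_k t] is bounded away from 0 and from
infinity, lies in the cone, and is at most its own image, because the transfer
operator is a finite positive sum.  Its iterates therefore increase to a fixed
function [h] of the cone ([exists_fixed_density]).  All limits are limits of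
sequences taken pointwise, so [h] is measurable.

It remains to lift [h] to the tower and to normalise it.  This uses that the
Jacobian is 1 almost everywhere below the top of the columns
([jacobian_eq1]), that the fibre of the tower map over a base point consists of
the points [(y_k z, k)] ([tower_mapP]), and that the lifted function has a
finite positive integral. *)

(** * Fixed functions of a weighted system of contractions *)

Section weighted_system.
Context d (X : measurableType d) (R : realType) (G : set X) (n : nat)
  (y : nat -> X -> X) (w : nat -> X -> R) (B : X -> X -> R) (beta c C : R).
Hypothesis mG : measurable G.
Hypothesis n_gt0 : (0 < n)%N.
Hypothesis yG : forall i x, G x -> G (y i x).
Hypothesis my : forall i, measurable_fun G (y i).
Hypothesis mw : forall i, measurable_fun G (w i).
Hypothesis w_gt0 : forall i x, G x -> 0 < w i x.
Hypothesis B01 : forall x x', 0 <= B x x' <= 1.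
Hypothesis By : forall i x x', G x -> G x' ->
  B (y i x) (y i x') <= beta * B x x'.
Hypothesis w_distortion : forall i x x', G x -> G x' ->
  w i x <= w i x' * expR (c * B x x').
Hypothesis C_ge0 : 0 <= C.
Hypothesis cC : c + beta * C <= C.

Definition transfer (t : R) (g : X -> R) (x : X) : R :=
  \sum_(i < n) t ^+ i.+1 * (w i x * g (y i x)).

(** The cone condition, with [B x x'] in the role of [beta ^ s(x, x')]. *)
Definition log_regular (g : X -> R) : Prop :=
  forall x x', G x -> G x' -> g x <= g x' * expR (C * B x x').

Local Notation K := (expR C).
Local Notation u t k := (iter k (transfer t) (cst 1)).

Lemma expR_C_ge1 : 1 <= K. Proof. by rewrite -expR0 ler_expR. Qed.

Lemma le_transfer t g g' : 0 <= t -> (forall x, G x -> g x <= g' x) ->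
  forall x, G x -> transfer t g x <= transfer t g' x.
Proof.
move=> t0 gg x Gx; apply: ler_sum => i _.
rewrite ler_wpM2l ?exprn_ge0// ler_wpM2l ?(ltW (w_gt0 _ _))// gg//.
exact: yG.
Qed.

Lemma transferZ t a g :
  transfer t (fun x => a * g x) = fun x => a * transfer t g x.
Proof.
apply/funext => x; rewrite /transfer mulr_sumr; apply: eq_bigr => i _.
by ring.
Qed.

Lemma transfer_ge0 t g : 0 <= t -> (forall x, G x -> 0 <= g x) ->
  forall x, G x -> 0 <= transfer t g x.
Proof.
move=> t0 g0 x Gx; apply: sumr_ge0 => i _.
by rewrite mulr_ge0 ?exprn_ge0// mulr_ge0 ?(ltW (w_gt0 _ _))// g0//; exact: yG.
Qed.

Lemma le_iter_transfer t g g' k : 0 <= t -> (forall x, G x -> g x <= g' x) ->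
  forall x, G x -> iter k (transfer t) g x <= iter k (transfer t) g' x.
Proof. by move=> t0 gg; elim: k => //= k IH; exact: le_transfer. Qed.

Lemma iter_transferZ t a g k :
  iter k (transfer t) (fun x => a * g x) = fun x => a * iter k (transfer t) g x.
Proof. by elim: k => //= k ->; rewrite transferZ. Qed.

Lemma iter_transfer_ge0 t g k : 0 <= t -> (forall x, G x -> 0 <= g x) ->
  forall x, G x -> 0 <= iter k (transfer t) g x.
Proof. by move=> t0 g0; elim: k => //= k IH; exact: transfer_ge0. Qed.

(** The branches shrink [B] by the factor [beta], so the distortion [C] of [g]
becomes [beta * C] and the weights add [c]: the sum is at most [C]. *)
Lemma log_regular_transfer t g : 0 <= t -> (forall x, G x -> 0 <= g x) ->
  log_regular g -> log_regular (transfer t g).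
Proof.
move=> t0 g0 gC x x' Gx Gx'; rewrite /transfer mulr_suml; apply: ler_sum => i _.
rewrite -mulrA ler_wpM2l ?exprn_ge0//.
have -> : w i x' * g (y i x') * expR (C * B x x') =
   w i x' * (g (y i x') * expR (C * B x x')) by rewrite mulrA.
apply: (@le_trans _ _ ((w i x' * expR (c * B x x')) *
    (g (y i x') * expR (C * B (y i x) (y i x'))))).
  apply: ler_pM; rewrite ?(ltW (w_gt0 _ _))//; first by apply: g0; exact: yG.
  - exact: w_distortion.
  - by apply: gC; exact: yG.
rewrite -mulrA ler_wpM2l ?(ltW (w_gt0 _ _))// mulrCA.
rewrite ler_wpM2l ?g0//; first exact: yG.
rewrite -expRD ler_expR.
apply: (@le_trans _ _ (c * B x x' + C * (beta * B x x'))).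
  by rewrite lerD2l ler_wpM2l// By.
rewrite mulrA -mulrDl ler_wpM2r//; first by have /andP[] := B01 x x'.
by rewrite [C * _]mulrC.
Qed.

Lemma log_regular_iter t g k : 0 <= t -> (forall x, G x -> 0 <= g x) ->
  log_regular g -> log_regular (iter k (transfer t) g).
Proof.
move=> t0 g0 gC; elim: k => //= k IH; apply: log_regular_transfer => //.
exact: iter_transfer_ge0.
Qed.

Lemma log_regular1 : log_regular (cst 1).
Proof.
move=> x x' _ _; rewrite /= mul1r -expR0 ler_expR mulr_ge0//.
by have /andP[] := B01 x x'.
Qed.

Lemma log_regular_le g x x' : (forall x, G x -> 0 <= g x) -> log_regular g ->
  G x -> G x' -> g x <= K * g x'.
Proof.
move=> g0 gC Gx Gx'; apply: (le_trans (gC _ _ Gx Gx')).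
rewrite mulrC ler_wpM2r ?g0// ler_expR ler_piMr//.
by have /andP[] := B01 x x'.
Qed.

Lemma iter1_ge0 t k x : 0 <= t -> G x -> 0 <= u t k x.
Proof. by move=> t0; apply: iter_transfer_ge0. Qed.

(** As [B <= 1], the values of an element of the cone agree up to the factor
[expR C]; this uniformity in the points replaces compactness below. *)
Lemma iter1_distortion t k x x' : 0 <= t -> G x -> G x' ->
  u t k x <= K * u t k x'.
Proof.
move=> t0; apply: log_regular_le; first by move=> *; exact: iter1_ge0.
by apply: log_regular_iter => //; exact: log_regular1.
Qed.

Lemma measurable_transfer t g :
  measurable_fun G g -> measurable_fun G (transfer t g).
Proof.
move=> mg; apply: measurable_sum => i.
apply: measurable_funM => //; apply: measurable_funM => //.
apply: (measurable_comp mG) => //.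
by move=> _ [x Gx <-]; exact: yG.
Qed.

Lemma measurable_iter_transfer t g k :
  measurable_fun G g -> measurable_fun G (iter k (transfer t) g).
Proof. by move=> mg; elim: k => //= k IH; exact: measurable_transfer. Qed.

Lemma cvg_transfer t (g_ : nat -> X -> R) g x :
  (forall x, G x -> g_ k x @[k --> \oo] --> g x) -> G x ->
  transfer t (g_ k) x @[k --> \oo] --> transfer t g x.
Proof.
move=> gg Gx; apply: cvg_big => [|i _]; first exact: add_continuous.
apply: cvgM; first exact: cvg_cst.
by apply: cvgM; [exact: cvg_cst|apply: gg; exact: yG].
Qed.

(** Each iterate is a polynomial in [t]. *)
Lemma continuous_iter1 k x : continuous (fun t => u t k x).
Proof.
elim: k x => [|k IH] x t; first exact: cvg_cst.
apply: cvg_big => [|i _]; first exact: add_continuous.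
apply: cvgM; first exact: exprn_continuous.
by apply: cvgM; [exact: cvg_cst|exact: IH].
Qed.

Definition bounded_iterates t :=
  exists M, forall k x, G x -> u t k x <= M.

(** A uniform lower bound on one iterate is multiplicative because the operator
is positive and homogeneous. *)
Lemma iter1_ge_geometric t a k m : 0 <= t -> 0 <= a ->
  (forall x, G x -> a <= u t k x) -> forall x, G x -> a ^+ m <= u t (m * k) x.
Proof.
move=> t0 a0 ak; elim: m => [|m IH] x Gx; first by [].
rewrite mulSn iterD exprS.
apply: (@le_trans _ _ (iter k (transfer t) (fun x => a ^+ m * cst 1 x) x));
  last first.
  by apply: le_iter_transfer => // z Gz; rewrite mulr1 IH.
by rewrite iter_transferZ mulrC ler_wpM2l ?exprn_ge0// ak.
Qed.

Lemma iter1_le_add t k m : 0 <= t ->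
  (forall x, G x -> u t k x <= 1) -> forall x, G x -> u t (m + k) x <= u t m x.
Proof. by move=> t0 uk x Gx; rewrite iterD; exact: le_iter_transfer. Qed.

(** A value above [K] at one point forces, by bounded distortion, a lower bound
larger than 1 at all points, hence geometric growth. *)
Lemma bounded_iter1_le t k x : 0 <= t -> bounded_iterates t -> G x ->
  u t k x <= K.
Proof.
move=> t0 [M uM] Gx; rewrite leNgt; apply/negP => Ku.
pose a := u t k x / K.
have a1 : 1 < a by rewrite ltr_pdivlMr ?expR_gt0// mul1r.
have ak z : G z -> a <= u t k z.
  by move=> Gz; rewrite ler_pdivrMr ?expR_gt0// mulrC; exact: iter1_distortion.
have a0 : 0 <= a by rewrite ltW// (lt_trans _ a1).
have aM m : (a - 1) *+ m <= M.
  apply: le_trans (_ : a ^+ m <= M); last first.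
    by rewrite (le_trans _ (uM (m * k)%N x Gx))// iter1_ge_geometric.
  elim: m => [|m IH]; first by rewrite mulr0n.
  have : 1 <= a ^+ m by rewrite exprn_ege1// ltW.
  rewrite mulrS exprS; nra.
have a10 : 0 < a - 1 by rewrite subr_gt0.
have := aM (Num.bound (M / (a - 1))).
rewrite -mulr_natl -ler_pdivlMr// leNgt => /negP; apply.
apply: archi_boundP.
rewrite divr_ge0 ?(ltW a10)//.
by rewrite (le_trans _ (uM 0%N x Gx)).
Qed.

(** A value of at most [K^-1] at one point bounds that iterate by 1 everywhere,
so the iterates are controlled by the first [k] of them. *)
Lemma bounded_iterates_of_small t k x : (0 < k)%N -> 0 <= t -> G x ->
  u t k x <= K^-1 -> bounded_iterates t.
Proof.
move=> k0 t0 Gx ukx.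
have uk z : G z -> u t k z <= 1.
  move=> Gz; apply: le_trans (iter1_distortion k t0 Gz Gx) _.
  by rewrite -ler_pdivlMl ?expR_gt0// mulr1.
have uqk q m z : G z -> u t (m + q * k) z <= u t m z.
  elim: q => [|q IH] Gz; first by rewrite addn0.
  by rewrite mulSnr addnA (le_trans _ (IH Gz))// iter1_le_add.
exists (\sum_(r < k) K * u t r x) => m z Gz.
rewrite (divn_eq m k) addnC (le_trans (uqk _ _ _ Gz))//.
have mk : (m %% k < k)%N by rewrite ltn_pmod.
rewrite (bigD1 (Ordinal mk))//= -[leLHS]addr0 lerD ?iter1_distortion//.
by apply: sumr_ge0 => i _; rewrite mulr_ge0 ?expR_ge0// iter1_ge0.
Qed.

(** The parameter is the supremum of those with bounded iterates. The upper
bound holds at smaller parameters and passes to the limit; if the lower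
bound failed, it would fail at slightly larger parameters too, and these
would have bounded iterates. *)
Lemma exists_critical_parameter : G !=set0 ->
  exists2 t, 0 < t & forall k x, G x -> K^-1 <= u t k x <= K.
Proof.
move=> [z0 Gz0].
pose S := [set t | 0 <= t /\ bounded_iterates t].
have K0 : 0 < K := expR_gt0 _.
(* for [t <= 1] the first iterate is at most [t * W] *)
have Si : exists2 t, 0 < t & S t.
  pose W := \sum_(i < n) w i z0.
  have W0 : 0 < W.
    rewrite /W (bigD1 (Ordinal n_gt0))//= ltr_wpDr ?w_gt0//.
    by apply: sumr_ge0 => i _; rewrite ltW ?w_gt0.
  exists (Num.min 1 (K * W)^-1).
    by rewrite lt_min ltr01/= invr_gt0 mulr_gt0.
  set t := Num.min _ _.
  have t0 : 0 < t by rewrite lt_min ltr01/= invr_gt0 mulr_gt0.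
  split; first exact: ltW.
  apply: (@bounded_iterates_of_small _ 1 z0) => //; first exact: ltW.
  rewrite /= /transfer.
  apply: (@le_trans _ _ (t * W)).
    rewrite /W mulr_sumr; apply: ler_sum => i _; rewrite mulr1.
    rewrite ler_wpM2r ?(ltW (w_gt0 _ _))// exprS ler_piMr ?(ltW t0)//.
    by rewrite exprn_ile1 ?(ltW t0)// ge_min lexx.
  by rewrite -ler_pdivlMr// -invfM /t ge_min lexx orbT.
have Sub : ubound S (K / w 0%N z0).
  move=> t [t0 bt]; rewrite ler_pdivlMr ?w_gt0//.
  apply: le_trans (bounded_iter1_le 1 t0 bt Gz0) => /=.
  rewrite /transfer (bigD1 (Ordinal n_gt0))//= expr1 mulr1 lerDl.
  apply: sumr_ge0 => i _.
  by rewrite mulr1 mulr_ge0 ?exprn_ge0// ltW ?w_gt0.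
have [t1 t10 St1] := Si.
have hS : has_sup S by split; [exists t1|exists (K / w 0%N z0)].
pose t := sup S.
have t1t : t1 <= t by apply: ub_le_sup => //; exists (K / w 0%N z0).
have t0 : 0 < t := lt_le_trans t10 t1t.
exists t => // k x Gx; apply/andP; split; rewrite leNgt; apply/negP => uk.
- have k0 : (0 < k)%N.
    case: k uk => // uk; exfalso; move: uk; rewrite /= ltNge => /negP; apply.
    by rewrite invf_le1 ?expR_C_ge1.
  (* a failure of the lower bound persists to the right of [t] *)
  have : \forall s \near t, u s k x < K^-1.
    exact: (cvgr_lt (u t k x) (@continuous_iter1 k x t)).
  move=> /nbhs_ballP[e /= e0 He].
  have : S (t + e / 2).
    split; first lra.
    apply: (@bounded_iterates_of_small _ k x) => //; first lra.
    apply/ltW/He; rewrite /ball /= opprD addrA subrr sub0r normrN.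
    by rewrite gtr0_norm; lra.
  move/(ub_le_sup (ex_intro _ _ Sub)); rewrite -/t; lra.
- (* a failure of the upper bound persists on the left, where [S] has points *)
  have : \forall s \near t, K < u s k x.
    exact: (cvgr_gt (u t k x) (@continuous_iter1 k x t)).
  move=> /nbhs_ballP[e /= e0 He].
  have [s Ss tes] := sup_adherent e0 hS.
  have st : s <= t by apply: ub_le_sup => //; exists (K / w 0%N z0).
  have : K < u s k x.
    by apply: He; rewrite /ball /= ger0_norm ?subr_ge0// -/t in tes *; lra.
  by rewrite ltNge bounded_iter1_le//; case: Ss.
Qed.

(** At the critical parameter the upper limit of the iterates of 1 is bounded
above and below and is at most its image; applying the operator again and
again then gives an increasing bounded sequence, whose limit is fixed. *)
Theorem exists_fixed_density : G !=set0 ->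
  exists t (h : X -> R), [/\ 0 < t, measurable_fun G h,
    forall x, G x -> 0 < h x, log_regular h &
    forall x, G x -> transfer t h x = h x].
Proof.
move=> G0; have [t t0 tK] := exists_critical_parameter G0.
have t0' := ltW t0.
have K0 : 0 < K := expR_gt0 _.
pose U x k := u t k x.
have U_ub x : G x -> has_ubound (range (U x)).
  by move=> Gx; exists K => _ [k _ <-]; have /andP[] := tK k x Gx.
have U_lb x : G x -> has_lbound (range (U x)).
  by move=> Gx; exists K^-1 => _ [k _ <-]; have /andP[] := tK k x Gx.
have U_sup x k m : G x -> (m <= k)%N -> U x k <= sups (U x) m.
  move=> Gx mk; apply: ub_le_sup; first exact/has_ubound_sdrop/U_ub.
  by exists k.
have sup_le x m M : G x -> (forall k, (m <= k)%N -> U x k <= M) ->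
    sups (U x) m <= M.
  move=> Gx UM; apply: ge_sup; first by exists (U x m), m => /=.
  by move=> _ [k /= mk <-]; exact: UM.
(* [v] is the upper limit of the iterates of 1, as the limit of the [sups] *)
pose v x := inf (range (sups (U x))).
have supsv x : G x -> sups (U x) @ \oo --> v x.
  by move=> Gx; apply: cvg_sups_inf; [exact: U_ub|exact: U_lb].
have vK x : G x -> K^-1 <= v x <= K.
  move=> Gx; apply/andP; split.
    apply: (cvgr_to_ge (supsv x Gx)); near=> m.
    apply: le_trans (U_sup x m m Gx (leqnn m)).
    by have /andP[] := tK m x Gx.
  apply: (cvgr_to_le (supsv x Gx)); near=> m.
  by apply: sup_le => // k _; have /andP[] := tK k x Gx.
have v_ge0 x : G x -> 0 <= v x.
  by move=> /vK /andP[+ _]; apply: le_trans; rewrite invr_ge0 ltW.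
have v_reg : log_regular v.
  move=> x x' Gx Gx'.
  apply: (ler_cvg_to (supsv x Gx)
    (cvgMr_tmp (b := expR (C * B x x')) (supsv x' Gx'))).
  near=> m; apply: sup_le => // k mk.
  have uk : log_regular (u t k) by exact: log_regular_iter log_regular1.
  apply: (le_trans (uk x x' Gx Gx')).
  by rewrite ler_wpM2r ?expR_ge0//; exact: (U_sup x' k m).
have mv : measurable_fun G v.
  apply: (measurable_fun_cvg (h := fun m x => sups (U x) m)) => //.
  move=> m; apply: (measurable_fun_sups (h := fun k x => U x k)) => // k.
  exact: measurable_iter_transfer.
(* the image of a tail supremum dominates the next tail supremum *)
have v_sub x : G x -> v x <= transfer t v x.
  move=> Gx.
  have := @cvg_transfer t (fun m z => sups (U z) m) v x supsv Gx.
  have /(_ x Gx) := supsv; rewrite -(cvg_shiftS (sups (U x))) => sv tv.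
  apply: (ler_cvg_to sv tv).
  near=> m; apply: sup_le => // -[//|k] mk.
  by apply: le_transfer => // z Gz; exact: U_sup.
pose V x k := iter k (transfer t) v x.
have V_nd x : G x -> nondecreasing_seq (V x).
  move=> Gx; apply/nondecreasing_seqP => k.
  by rewrite /V iterSr; exact: le_iter_transfer.
have V_ub x : G x -> has_ubound (range (V x)).
  move=> Gx; exists (K * K) => _ [k _ <-].
  apply: le_trans (_ : iter k (transfer t) (fun z => K * cst 1 z) x <= _).
    by apply: le_iter_transfer => // z /vK /andP[_]; rewrite mulr1.
  by rewrite iter_transferZ ler_wpM2l ?(ltW K0)//; have /andP[] := tK k x Gx.
pose h x := sup (range (V x)).
have Vh x : G x -> V x @ \oo --> h x.
  by move=> Gx; apply: nondecreasing_cvgn; [exact: V_nd|exact: V_ub].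
exists t, h; split => //.
- apply: (measurable_fun_cvg (h := fun m x => V x m)) => // m.
  exact: measurable_iter_transfer.
- move=> x Gx; apply: (@lt_le_trans _ _ (v x)).
    by have /andP[+ _] := vK x Gx; apply: lt_le_trans; rewrite invr_gt0.
  by apply: ub_le_sup; [exact: V_ub|exists 0%N].
- move=> x x' Gx Gx'.
  apply: (ler_cvg_to (Vh x Gx)
    (cvgMr_tmp (b := expR (C * B x x')) (Vh x' Gx'))).
  by near=> k; exact: log_regular_iter.
- move=> x Gx.
  have := @cvg_transfer t (fun m z => V z m) h x Vh Gx.
  have /(_ x Gx) := Vh; rewrite -(cvg_shiftS (V x)) => sv tv.
  exact: (cvg_unique _ tv sv).
Unshelve. all: by end_near. Qed.

End weighted_system.

(** * Inverse branches of the first return map *)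

Section branch_inverse.
Context (R : realType) (T : R -> R) (a b : R).
Hypothesis ab : a <= b.
Hypothesis T_bij : set_bij `]a, b[ `]0, 1[ T.
Hypothesis T_incr : forall x y, a < x -> x < y -> y < b -> T x < T y.

(** Outside the unit interval the inverse is continued by constants, so that it
is monotone on the whole line and hence measurable. *)
Definition branch_inverse (u : R) : R :=
  if u <= 0 then a else if 1 <= u then b
  else xget a [set x | a < x < b /\ T x = u].

Lemma branch_inverseP u : 0 < u < 1 ->
  a < branch_inverse u < b /\ T (branch_inverse u) = u.
Proof.
move=> /andP[u0 u1]; rewrite /branch_inverse leNgt u0/= leNgt u1/=.
case: xgetP => [//|Nx]; exfalso.
have [_ _ surjT] := T_bij.
have [|x/=] := surjT u; first by rewrite /= in_itv/= u0.
by rewrite in_itv/= => xab Txu; apply: (Nx x).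
Qed.

Lemma branch_inverseK x : a < x < b -> branch_inverse (T x) = x.
Proof.
move=> xab; have [funT injT _] := T_bij.
have := funT x; rewrite /= !in_itv/= => /(_ xab) Tx01.
have [iab iT] := branch_inverseP Tx01.
by apply: injT => //; rewrite inE/= in_itv.
Qed.

Lemma branch_inverse_bounds u : a <= branch_inverse u <= b.
Proof.
have [u0|u0] := leP u 0; first by rewrite /branch_inverse u0 lexx.
have [u1|u1] := leP 1 u.
  have -> : branch_inverse u = b by rewrite /branch_inverse leNgt u0/= u1.
  by rewrite ab lexx.
have /branch_inverseP[/andP[/ltW -> /ltW ->]//] : 0 < u < 1 by rewrite u0.
Qed.

Lemma branch_inverse_nondecreasing : {homo branch_inverse : u v / u <= v}.
Proof.
move=> u v uv.
have [u0|u0] := leP u 0.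
  by rewrite {1}/branch_inverse u0; have /andP[] := branch_inverse_bounds v.
have [v1|v1] := leP 1 v.
  have -> : branch_inverse v = b.
    by rewrite /branch_inverse leNgt (lt_le_trans u0 uv)/= v1.
  by have /andP[] := branch_inverse_bounds u.
have [|/andP[_ ub] Tu] := @branch_inverseP u.
  by rewrite u0 (le_lt_trans uv v1).
have [|/andP[av _] Tv] := @branch_inverseP v.
  by rewrite v1 (lt_le_trans u0 uv).
rewrite leNgt; apply/negP => vu.
by have := T_incr av vu ub; rewrite Tu Tv ltNge uv.
Qed.

Lemma measurable_branch_inverse : measurable_fun setT branch_inverse.
Proof.
by apply: nondecreasing_measurable => //; exact: branch_inverse_nondecreasing.
Qed.

End branch_inverse.

Section return_time_facts.
Context (R : realType) (T : R -> R) (x0 : R).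
Local Notation return_time := (return_time T x0).
Local Notation returns_at := (returns_at T x0).

Lemma return_timeP x k : return_time x = k.+1 <->
  returns_at x k.+1 /\ forall j, (j <= k)%N -> ~~ returns_at x j.
Proof.
rewrite /Defs.return_time; case: pselect => [ex|nex]; last first.
  by split=> // -[rx _]; exfalso; apply: nex; exists k.+1.
case: ex_minnP => m rm minm; split=> [mk|[rk Nk]].
  rewrite -mk; split=> // j jk; apply/negP => /minm; rewrite mk.
  by rewrite ltnNge jk.
apply/eqP; rewrite eqn_leq minm//= ltnNge; apply/negP => /Nk.
by rewrite rm.
Qed.

Lemma base_cellP i x : (0 < i)%N -> base_cell T x0 i x <->
  [/\ base x0 x, returns_at x i & forall j, (j < i)%N -> ~~ returns_at x j].
Proof.
case: i => // i _; split.
  by move=> [bx /return_timeP[ri Nj]].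
by move=> [bx ri Nj]; split => //; apply/return_timeP.
Qed.

End return_time_facts.

Section branches.
Context (R : realType) (alpha x0 : R) (T : R -> R).
Hypothesis pm : pomeau_manneville alpha x0 T.

Let x0_gt0 : 0 < x0. Proof. by have /andP[] := pm_x0 pm. Qed.
Let x0_lt1 : x0 < 1. Proof. by have /andP[] := pm_x0 pm. Qed.

Lemma pm_left_derivable x : 0 < x < x0 -> derivable T x 1.
Proof.
move=> /andP[x_gt0 xx0].
have e0 : 0 < x / 2 by rewrite divr_gt0.
have [|] := pm_C2_left pm e0 (x := x); last by [].
by rewrite /= in_itv/= xx0 andbT ltr_pdivrMr// ltr_pMr// ltr1n.
Qed.

Lemma pm_right_derivable x : x0 < x < 1 -> derivable T x 1.
Proof. by move=> x01; have [|] := pm_C2_right pm (x := x). Qed.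

Lemma derive_gt1_increasing a b :
  (forall x, a < x < b -> derivable T x 1) ->
  (forall x, a < x < b -> 1 < T^`() x) ->
  forall x y, a < x -> x < y -> y < b -> T x < T y.
Proof.
move=> dT T1 x y ax xy yb.
apply: (@gtr0_derive1_lt_oo _ T a b) => //.
- by move=> z; rewrite in_itv/= => /T1; exact: lt_trans.
- move=> z; rewrite inE/= in_itv/= => /dT dz.
  by apply: differentiable_continuous; exact/derivable1_diffP.
- by rewrite in_itv/= ax (lt_trans xy).
- by rewrite in_itv/= yb (lt_trans ax).
Qed.

Local Notation phi0 := (branch_inverse T 0 x0).
Local Notation phi1 := (branch_inverse T x0 1).

Lemma phi0P u : 0 < u < 1 -> 0 < phi0 u < x0 /\ T (phi0 u) = u.
Proof. by apply: branch_inverseP; exact: (pm_branch_left pm). Qed.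

Lemma phi1P u : 0 < u < 1 -> x0 < phi1 u < 1 /\ T (phi1 u) = u.
Proof. by apply: branch_inverseP; exact: (pm_branch_right pm). Qed.

Lemma phi0K x : 0 < x < x0 -> phi0 (T x) = x.
Proof. by apply: branch_inverseK; exact: (pm_branch_left pm). Qed.

Lemma phi1K x : x0 < x < 1 -> phi1 (T x) = x.
Proof. by apply: branch_inverseK; exact: (pm_branch_right pm). Qed.

Lemma measurable_phi0 : measurable_fun setT phi0.
Proof.
apply: measurable_branch_inverse; first exact: ltW.
  exact: (pm_branch_left pm).
apply: derive_gt1_increasing; first exact: pm_left_derivable.
exact: pm_expanding_left pm.
Qed.

Lemma measurable_phi1 : measurable_fun setT phi1.
Proof.
apply: measurable_branch_inverse; first exact: ltW.
  exact: (pm_branch_right pm).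
apply: derive_gt1_increasing; first exact: pm_right_derivable.
exact: pm_expanding_right pm.
Qed.

(** The point of the base with return time [k.+1] that returns to [z]: the
preimage under the right branch of the [k]-th preimage under the left
branch. *)
Definition return_branch (k : nat) (z : R) : R := phi1 (iter k phi0 z).

Lemma measurable_return_branch k : measurable_fun setT (return_branch k).
Proof.
apply: measurableT_comp; first exact: measurable_phi1.
elim: k => [|k IH]; first exact: measurable_id.
by apply: measurableT_comp IH; exact: measurable_phi0.
Qed.

Lemma iter_phi0_itv k z : 0 < z < 1 -> 0 < iter k phi0 z < 1.
Proof.
move=> z01; elim: k => //= k /phi0P[/andP[-> h] _]; exact: lt_trans h x0_lt1.
Qed.

Lemma iter_phi0_left k z : 0 < z < 1 -> 0 < iter k.+1 phi0 z < x0.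
Proof. by move=> z01; have [] := phi0P (iter_phi0_itv k z01). Qed.

Lemma iter_T_phi0 j m z : 0 < z < 1 ->
  iter j T (iter (j + m) phi0 z) = iter m phi0 z.
Proof.
move=> z01; elim: j => // j IH; rewrite iterSr -[RHS]IH addSn iterS.
by have [_ ->] := phi0P (iter_phi0_itv (j + m) z01).
Qed.

Lemma iter_T_return_branch k j z : 0 < z < 1 -> (j <= k)%N ->
  iter j.+1 T (return_branch k z) = iter (k - j) phi0 z.
Proof.
move=> z01 jk; rewrite iterSr /return_branch.
have [_ ->] := phi1P (iter_phi0_itv k z01).
by rewrite -{1}(subnKC jk) iter_T_phi0.
Qed.

Lemma itv_right_unit z : x0 < z < 1 -> 0 < z < 1.
Proof. by move=> /andP[h ->]; rewrite (lt_trans x0_gt0 h). Qed.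

Lemma return_branch_itv k z : x0 < z < 1 -> x0 < return_branch k z < 1.
Proof.
by move=> /itv_right_unit z01; have [] := phi1P (iter_phi0_itv k z01).
Qed.

Lemma return_branchP k z : x0 < z < 1 ->
  [/\ base x0 (return_branch k z), return_time T x0 (return_branch k z) = k.+1 &
      iter k.+1 T (return_branch k z) = z].
Proof.
move=> zx; have z01 := itv_right_unit zx; split.
- rewrite /base /= in_itv/=.
  by have /andP[/ltW -> /ltW ->] := return_branch_itv k zx.
- apply/return_timeP; split.
    by rewrite /returns_at iter_T_return_branch// subnn.
  case=> // j jk.
  rewrite /returns_at iter_T_return_branch; [|by []|exact: ltnW].
  have -> : (k - j = (k - j.+1).+1)%N by lia.
  have /andP[_ h] := iter_phi0_left (k - j.+1) z01.
  by rewrite negb_and ltNge (ltW h).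
- by rewrite iter_T_return_branch// subnn.
Qed.

(** The orbits of the end points of the two branches, where the values of [T]
are unconstrained. *)
Definition singular_orbits : set R :=
  \bigcup_k [set iter k T a | a in [set a | a \in [:: 0; x0; 1]]].

(** Preimages of a point that is off the singular orbits are off them too, so
the return branches act on this set. *)
Definition regular_points : set R := `]x0, 1[ `\` singular_orbits.

Lemma countable_singular_orbits : countable singular_orbits.
Proof.
apply: bigcup_countable => // k _; apply: sub_countable (card_image_le _ _) _.
exact/finite_set_countable/finite_seq.
Qed.

Lemma measurable_regular_points : measurable regular_points.
Proof.
apply: measurableD; first exact: measurable_itv.
apply: countable_measurable; last exact: countable_singular_orbits.
exact: measurable_set1.
Qed.

Lemma regular_points_itv z : regular_points z -> x0 < z < 1.
Proof. by move=> [+ _]; rewrite /= in_itv. Qed.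

(** The base has positive length and the singular orbits are countable. *)
Lemma regular_points_nonempty : regular_points !=set0.
Proof.
apply/set0P/negP => /eqP G0.
have : lebesgue_measure (`]x0, 1[%classic : set R) = 0%E.
  apply: countable_lebesgue_measure0.
  apply: sub_countable countable_singular_orbits.
  by apply: subset_card_le; rewrite -setD_eq0.
rewrite lebesgue_measure_itv/= lte_fin x0_lt1 -EFinD => -[] /eqP.
by rewrite subr_eq0 => /eqP x01; move: x0_lt1; rewrite -x01 ltxx.
Qed.

Lemma regular_return_branch k z :
  regular_points z -> regular_points (return_branch k z).
Proof.
move=> Gz; have zx := regular_points_itv Gz; split.
  by rewrite /= in_itv/=; exact: return_branch_itv.
move=> [j _ [a ha aj]]; case: Gz => _; apply.
exists (k.+1 + j)%N => //; exists a => //.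
by rewrite iterD aj; have [] := return_branchP k zx.
Qed.

Lemma iter_T_unit q j : 0 <= q <= 1 -> 0 <= iter j T q <= 1.
Proof.
move=> q01; elim: j => //= j IH.
by have := pm_maps pm (x := iter j T q); rewrite /= !in_itv/=; exact.
Qed.

(** The orbit of [q] avoids the end points since it ends outside the singular
orbits, and before its return it stays in the left branch; so it can be
followed backwards by the two branch inverses. *)
Lemma return_branch_unique q k z : regular_points z -> base x0 q ->
  return_time T x0 q = k.+1 -> iter k.+1 T q = z -> q = return_branch k z.
Proof.
move=> Gz bq /return_timeP[rk Nr] qz.
have q01 : 0 <= q <= 1.
  move: bq; rewrite /base /= in_itv/= => /andP[h ->].
  by rewrite (le_trans (ltW x0_gt0) h).
have Nsing j a : (j <= k)%N -> a \in [:: 0; x0; 1] -> iter j T q <> a.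
  move=> jk ha ja; case: Gz => _; apply.
  exists (k.+1 - j)%N => //; exists a => //.
  by rewrite -ja -iterD subnK ?qz// ltnW.
have left j : (0 < j <= k)%N -> 0 < iter j T q < x0.
  move=> /andP[j0 jk]; have /andP[h0 h1] := iter_T_unit j q01.
  have n0 := Nsing j 0 jk; have nx0 := Nsing j x0 jk; have n1 := Nsing j 1 jk.
  rewrite !inE !eqxx ?orbT in n0 nx0 n1.
  have := Nr j jk; rewrite /returns_at j0/= negb_and -!leNgt.
  have e0 : (iter j T q != 0) by apply/eqP/n0.
  have ex0 : (iter j T q != x0) by apply/eqP/nx0.
  have e1 : (iter j T q != 1) by apply/eqP/n1.
  move=> /orP[h|h]; first by rewrite !lt_neqAle h0 ex0 h eq_sym e0.
  by move: e1; rewrite eq_le h h1.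
have step m : (m <= k)%N -> iter m phi0 z = iter (k.+1 - m) T q.
  elim: m => [|m IH] mk; first by rewrite subn0.
  rewrite iterS IH 1?ltnW//; have -> : (k.+1 - m = (k.+1 - m.+1).+1)%N by lia.
  by rewrite iterS phi0K//; apply: left; lia.
rewrite /return_branch step// subSnn /= phi1K//.
have := Nsing 0%N x0 (leq0n _); have := Nsing 0%N 1 (leq0n _).
rewrite !inE !eqxx ?orbT => /(_ erefl) /eqP q1 /(_ erefl) /eqP qx.
move: bq; rewrite /base /= in_itv/= => /andP[xq q1'].
by rewrite !lt_neqAle xq q1' q1 eq_sym qx.
Qed.

Lemma return_map_branch k z : regular_points z ->
  return_map T x0 (return_branch k z) = z.
Proof.
move=> /regular_points_itv zx; have [_ rt it] := return_branchP k zx.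
by rewrite /return_map rt.
Qed.

Lemma tower_mapP p z : regular_points z ->
  (tower T x0 p /\ tower_map T x0 p = (z, 0%N)) <->
  exists k, p = (return_branch k z, k).
Proof.
move=> Gz; split.
  case: p => q l [[/= bq lq]]; rewrite /tower_map/=; case: ltnP => // ql [] qz.
  exists l; congr pair.
  have rt : return_time T x0 q = l.+1 by apply/eqP; rewrite eqn_leq ql lq.
  by apply: return_branch_unique => //; rewrite -qz /return_map rt.
move=> [k ->]; have zx := regular_points_itv Gz.
have [bq rt it] := return_branchP k zx.
split; first by split=> //=; rewrite rt.
by rewrite /tower_map/= rt ltnn return_map_branch.
Qed.


End branches.

(** * Measure theory on the tower *)

Import HBNNSimple.

Section ae_integral.
Context d (X : measurableType d) (R : realType).
Variable mu : {measure set X -> \bar R}.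
Local Open Scope ereal_scope.

(** Stated for arbitrary functions because it is applied to an image under the
Perron-Frobenius operator, which is known only up to a null set.
Restricting a simple function below [f] to the complement of [N] keeps its
integral and puts it below [g]. *)
Lemma ge0_ae_le_integralT (f g : X -> \bar R) (N : set X) :
  (forall x, 0 <= f x) -> (forall x, 0 <= g x) ->
  measurable N -> mu N = 0 -> (forall x, ~ N x -> f x <= g x) ->
  \int[mu]_x f x <= \int[mu]_x g x.
Proof.
move=> f0 g0 mN N0 fg; rewrite !ge0_integralTE//.
apply: ge_ereal_sup => _ [h /= hf <-].
have mCN : measurable (~` N) := measurableC mN.
apply: ereal_sup_ubound; exists (proj_nnsfun h mCN) => /=.
  move=> x; rewrite mindicE; have [|xN] := boolP (x \in ~` N).
    by rewrite inE => /fg fgx; rewrite mulr1 (le_trans (hf x)).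
  by rewrite mulr0.
rewrite -!integralT_nnsfun; apply: ae_eq_integral => //.
- by apply: measurableT_comp; [exact: EFin_measurable|exact: measurable_funPT].
- by apply: measurableT_comp; [exact: EFin_measurable|exact: measurable_funPT].
exists N; split => // x; apply: contra_notP => xN _ /=.
by rewrite mindicE mem_set// mulr1.
Qed.

Lemma ge0_ae_le_integral (D : set X) (f g : X -> \bar R) :
  (forall x, 0 <= f x) -> (forall x, 0 <= g x) ->
  {ae mu, forall x, D x -> f x <= g x} ->
  \int[mu]_(x in D) f x <= \int[mu]_(x in D) g x.
Proof.
move=> f0 g0 [N [mN N0 fgN]].
have patch0 (k : X -> \bar R) :
    (forall x, 0 <= k x) -> forall x, 0 <= (k \_ D) x.
  by move=> k0 x; rewrite patchE; case: ifP.
rewrite integral_mkcond [leRHS]integral_mkcond.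
apply: (ge0_ae_le_integralT _ _ mN N0); [exact: patch0|exact: patch0|].
move=> x Nx; rewrite !patchE; case: ifPn => // /set_mem Dx.
by apply: contrapT => fgx; apply: Nx; apply: fgN => /(_ Dx).
Qed.

Lemma ge0_ae_eq_integral_nonmeasurable (D : set X) (f g : X -> \bar R) :
  (forall x, 0 <= f x) -> (forall x, 0 <= g x) ->
  {ae mu, forall x, D x -> f x = g x} ->
  \int[mu]_(x in D) f x = \int[mu]_(x in D) g x.
Proof.
move=> f0 g0 fg; apply/eqP; rewrite eq_le; apply/andP; split;
  apply: ge0_ae_le_integral => //; apply: filterS fg => x /= h /h -> //.
Qed.

End ae_integral.

Section levels.
Context {R : realType}.
Local Notation nu := (@tower_measure R).
Local Notation leb := (@lebesgue_measure R).

Lemma tower_measure_level (A : set (measurableTypeR R)) l :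
  measurable A -> nu (A `*` [set l]) = leb A.
Proof.
move=> mA; rewrite /tower_measure product_measure1E//.
by rewrite /= /counting asboolT// fset_set1 finmap.cardfs1 mule1.
Qed.

(** Counting measure charges every level, so a slice of a null set is null.
This brings almost everywhere statements about the Jacobian down to the
base. *)
Lemma negligible_level (A : set (measurableTypeR R * nat)) l :
  nu.-negligible A -> leb.-negligible [set x | A (x, l)].
Proof.
move=> [B [mB B0 AB]]; exists (ysection B l); split.
- exact: measurable_ysection.
- have mBl : measurable (ysection B l) by exact: measurable_ysection.
  apply/eqP; rewrite eq_le measure_ge0 andbT -(tower_measure_level l mBl) -B0.
  apply: le_measure; rewrite ?inE//; first exact: measurableX.
  by move=> [x k] [/= + ->]; rewrite /ysection/= inE.
- by move=> x /= /AB; rewrite /ysection/= inE.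
Qed.

Lemma negligible_columns (A : set (measurableTypeR R)) :
  leb.-negligible A -> nu.-negligible [set p | A p.1].
Proof.
move=> [B [mB B0 AB]]; exists (B `*` setT); split.
- exact: measurableX.
- by rewrite /tower_measure product_measure1E// [X in (X * _)%E]B0 mul0e.
- by move=> p /= /AB.
Qed.

Lemma negligible_pairs (A : set (measurableTypeR R * nat)) :
  nu.-negligible A ->
  (nu \x nu)%E.-negligible [set pq | A pq.1 \/ A pq.2].
Proof.
move=> [B [mB B0 AB]]; exists ((B `*` setT) `|` (setT `*` B)); split.
- by apply: measurableU; exact: measurableX.
- apply/eqP; rewrite eq_le measure_ge0 andbT.
  apply: le_trans (measureU2 _ _ _) _; [exact: measurableX|exact: measurableX|].
  rewrite /= !product_measure1E// [X in (X * _ + _)%E]B0 [X in (_ + _ * X)%E]B0.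
  by rewrite mul0e mule0 adde0.
- by move=> pq /= [/AB|/AB]; [left|right].
Qed.

End levels.

Section tower_measurability.
Context (R : realType) (alpha x0 : R) (T : R -> R).
Hypothesis pm : pomeau_manneville alpha x0 T.
Let x0_gt0 : 0 < x0. Proof. by have /andP[] := pm_x0 pm. Qed.
Let x0_lt1 : x0 < 1. Proof. by have /andP[] := pm_x0 pm. Qed.
Local Notation point := (measurableTypeR R * nat)%type.

Lemma measurable_T : measurable_fun (`[0, 1] : set (measurableTypeR R)) T.
Proof.
have -> : (`[0, 1] : set R) =
    ([set 0] `|` `]0, x0[) `|` ([set x0] `|` `]x0, 1[) `|` [set 1].
  apply/seteqP; split=> x /=; rewrite !in_itv/=.
    move=> /andP[]; rewrite !le_eqVlt => /orP[/eqP <-|xgt].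
      by left; left; left.
    move=> /orP[/eqP ->|xlt]; first by right.
    have [xx|xx|xx] := ltgtP x x0; left.
    - by left; right; rewrite xgt.
    - by right; right; rewrite xlt.
    - by right; left.
  move=> [[[->|/andP[a b]]|[->|/andP[a b]]]|->]; rewrite ?lexx ?ler01//.
  - by rewrite (ltW a) (ltW (lt_trans b x0_lt1)).
  - by rewrite !ltW.
  - by rewrite (ltW b) (ltW (lt_trans x0_gt0 a)).
have open_part (a b : R) : (forall x, a < x < b -> derivable T x 1) ->
    measurable_fun (`]a, b[ : set (measurableTypeR R)) T.
  move=> dT; apply: open_continuous_measurable_fun; first exact: interval_open.
  move=> x; rewrite inE/= in_itv/= => /dT dx.
  by apply: differentiable_continuous; exact/derivable1_diffP.
have m1 (a : R) : measurable ([set a] : set (measurableTypeR R)).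
  exact: measurable_set1.
have mi (a b : R) : measurable (`]a, b[ : set (measurableTypeR R)).
  exact: measurable_itv.
repeat (apply/measurable_funU; do ?[exact: measurableU|exact: m1|exact: mi| 
   apply: measurableU]; split); do ?exact: measurable_fun_set1.
- by apply: open_part => x; exact: (pm_left_derivable pm).
- by apply: open_part => x; exact: (pm_right_derivable pm).
Qed.

Lemma measurable_base : measurable (base x0 : set (measurableTypeR R)).
Proof. exact: measurable_itv. Qed.

Lemma base_unit x : base x0 x -> 0 <= x <= 1.
Proof.
by rewrite /base /= in_itv/= => /andP[h ->]; rewrite (le_trans (ltW x0_gt0) h).
Qed.

Lemma measurable_iter_T k :
  measurable_fun (`[0, 1] : set (measurableTypeR R)) (iter k T).
Proof.
elim: k => [|k IH]; first exact: measurable_id.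
apply: (measurable_comp _ _ measurable_T IH); first exact: measurable_itv.
by move=> _ [x /= + <-]; rewrite !in_itv/=; exact: (iter_T_unit pm).
Qed.

Lemma measurable_returns_at k :
  measurable [set x : measurableTypeR R | base x0 x /\ returns_at T x0 x k].
Proof.
case: k => [|k].
  rewrite (_ : [set _ | _] = set0)//; apply/seteqP; split => // x [] //.
have -> : [set x | base x0 x /\ returns_at T x0 x k.+1] =
    base x0 `&` (iter k.+1 T @^-1` `]x0, 1[).
  by apply/seteqP; split => x /= []; rewrite /returns_at/= in_itv.
have mk : measurable_fun (base x0 : set (measurableTypeR R)) (iter k.+1 T).
  apply: measurable_funS (measurable_iter_T k.+1); first exact: measurable_itv.
  by move=> x /base_unit; rewrite /= in_itv.
by apply: mk; [exact: measurable_base|exact: measurable_itv].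
Qed.

Lemma measurable_base_cell i : (0 < i)%N ->
  measurable (base_cell T x0 i : set (measurableTypeR R)).
Proof.
move=> i0.
have -> : base_cell T x0 i = [set x | base x0 x /\ returns_at T x0 x i] `\`
    \bigcup_(j in `I_i) [set x | base x0 x /\ returns_at T x0 x j].
  apply/seteqP; split => x.
    move=> /base_cellP-/(_ i0) [bx ri Nj]; split => // -[j /= ji [_ rj]].
    by have := Nj j ji; rewrite rj.
  move=> [[bx ri] Nj]; apply/base_cellP => //; split=> // j ji.
  by apply/negP => rj; apply: Nj; exists j.
apply: measurableD; first exact: measurable_returns_at.
by apply: bigcup_measurable => j _; exact: measurable_returns_at.
Qed.

Lemma cellE l i : (l < i)%N -> cell T x0 l i = base_cell T x0 i `*` [set l].
Proof.
move=> li; apply/seteqP; split => [p [bp pl _]|p [bp pl]]; first by split.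
by split.
Qed.

Lemma measurable_cell l i : measurable (cell T x0 l i : set point).
Proof.
have [li|il] := ltnP l i; last first.
  rewrite (_ : cell _ _ _ _ = set0)//; apply/seteqP; split=> // p [_ _].
  by rewrite ltnNge il.
rewrite cellE//; apply: measurableX => //; apply: measurable_base_cell.
exact: leq_ltn_trans li.
Qed.

Lemma tower_cell p : tower T x0 p -> cell T x0 p.2 (return_time T x0 p.1) p.
Proof. by move=> [bp lp]; split. Qed.

Lemma cell_tower l i : cell T x0 l i `<=` tower T x0.
Proof. by move=> p [[bp ri] pl li]; split=> //; rewrite ri pl. Qed.

Lemma measurable_tower : measurable (tower T x0 : set point).
Proof.
have -> : tower T x0 = \bigcup_l \bigcup_i cell T x0 l i.
  apply/seteqP; split=> [p /tower_cell cp|p [l _ [i _]]].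
    by exists p.2 => //; exists (return_time T x0 p.1).
  exact: cell_tower.
by apply: bigcup_measurable => l _; apply: bigcup_measurable => i _;
  exact: measurable_cell.
Qed.

Lemma measurable_hole n : measurable (hole T x0 n : set point).
Proof.
by apply: bigcup_measurable => i _; apply: bigcup_measurable => l _;
  exact: measurable_cell.
Qed.

Lemma hole_cell n l i p : cell T x0 l i p ->
  hole T x0 n p <-> (0 < l)%N /\ (n < i)%N.
Proof.
move=> cp; split.
  move=> [i' /= ni [l' /= /andP[l0 li]]] [[_ ri'] pl' _].
  by case: cp => -[_ ri] pl _; rewrite -ri -pl ri' pl'.
move=> [l0 ni]; exists i => //; exists l => //=.
by case: cp => _ _ ->; rewrite l0.
Qed.

Lemma hole_ground n x : ~ hole T x0 n (x, 0%N).
Proof.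
by move=> [i _ [l /= /andP[l0 _]]] [_ /= l0' _]; move: l0; rewrite -l0'.
Qed.

Lemma tower_measure_cell_fin l i : (tower_measure (cell T x0 l i) < +oo)%E.
Proof.
have [li|il] := ltnP l i; last first.
  rewrite (_ : cell _ _ _ _ = set0) ?measure0//.
  apply/seteqP; split=> // p [_ _].
  by rewrite ltnNge il.
have i0 : (0 < i)%N by exact: leq_ltn_trans li.
rewrite cellE// tower_measure_level; last exact: measurable_base_cell.
apply: (@le_lt_trans _ _ (lebesgue_measure (base x0 : set R))).
  apply: le_measure; rewrite ?inE;
    [exact: measurable_base_cell|exact: measurable_itv|].
  by move=> x [].
by rewrite /base lebesgue_measure_itv/= lte_fin x0_lt1 -EFinD ltry.
Qed.

Section jacobian.
Variable JF : point -> R.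
Hypothesis jacJF : is_jacobian T x0 JF.

(** Below the top of a column the tower map is a vertical translation, so the
integrals of the Jacobian and of 1 agree on all measurable subsets of the
cell. *)
Lemma jacobian_eq1_cell l i : (l.+1 < i)%N ->
  {ae @tower_measure R, forall p, cell T x0 l i p -> JF p = 1}.
Proof.
move=> li; have [mJ J0 Jint] := jacJF.
have mD := measurable_cell l i.
have : ae_eq (@tower_measure R) (cell T x0 l i) (cst 1%E) (EFin \o JF).
  apply: integral_ae_eq => //.
  - apply/integrableP; split; first exact: measurable_cst.
    rewrite (eq_integral (cst 1%E)); last by move=> p _ /=; rewrite normr1.
    by rewrite integral_cst// mul1e; exact: tower_measure_cell_fin.
  - apply/measurable_EFinP; apply: measurable_funS mJ.
      exact: measurable_tower.
    exact: cell_tower.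
  move=> E Ecell mE; rewrite integral_cst// mul1e.
  rewrite /= -(Jint _ _ _ mE Ecell).
  have mEl : measurable (ysection E l) by exact: measurable_ysection.
  have -> : E = ysection E l `*` [set l].
    apply/seteqP; split=> [[x k] Exk|[x k] [/= + ->]].
      have [_ /= kl _] := Ecell _ Exk.
      by split => //=; rewrite /ysection/= inE -kl.
    by rewrite /ysection/= inE.
  have -> : tower_map T x0 @` (ysection E l `*` [set l]) =
      ysection E l `*` [set l.+1].
    have up x : E (x, l) -> tower_map T x0 (x, l) = (x, l.+1).
      by move=> /Ecell [[_ /= rx] _ _]; rewrite /tower_map/= rx li.
    apply/seteqP; split.
      move=> _ [[x k] [/= xE ->] <-]; rewrite up//.
      by move: xE; rewrite /ysection/= inE.
    move=> [x k] [/= xE ->]; exists (x, l) => //.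
    by rewrite up//; move: xE; rewrite /ysection/= inE.
  by rewrite !tower_measure_level.
by apply: filterS => p /= h /h [].
Qed.

(** Stated for base points so that one null set of columns serves all levels. *)
Lemma jacobian_eq1 :
  {ae @lebesgue_measure R, forall x, base x0 x ->
    forall l, (l.+1 < return_time T x0 x)%N -> JF (x, l) = 1}.
Proof.
have : {ae @lebesgue_measure R, forall x l i, (l.+1 < i)%N ->
    cell T x0 l i (x, l) -> JF (x, l) = 1}.
  apply: ae_foralln => l; apply: ae_foralln => i.
  have [li|il] := ltnP l.+1 i; last by apply: aeW => x.
  have := jacobian_eq1_cell li => /negligible_level -/(_ l).
  by apply: negligibleS => x /=; apply: contra_not => h _; exact: h.
apply: filterS => x h bx l lr; apply: (h l _ lr).
by split => //=; exact: ltnW.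
Qed.

End jacobian.

End tower_measurability.

(** * Separation times and the Perron-Frobenius operator on the base *)

Section separation.
Context (R : realType) (x0 beta : R) (T : R -> R).
Hypothesis beta01 : 0 < beta < 1.
Local Notation point := (measurableTypeR R * nat)%type.

Lemma separated_atC x y k : separated_at T x0 x y k = separated_at T x0 y x k.
Proof.
by rewrite /separated_at; congr (~~ `[< _ >]); apply/propext;
  split=> -[i [? ? ?]]; exists i.
Qed.

Lemma separation_powC (p q : point) :
  separation_pow T x0 beta p q = separation_pow T x0 beta q p.
Proof.
rewrite /separation_pow /separation_time.
have -> : separated_at T x0 p.1 q.1 = separated_at T x0 q.1 p.1.
  by apply/funext => k; exact: separated_atC.
by [].
Qed.

Lemma separation_pow_itv (p q : point) : 0 <= separation_pow T x0 beta p q <= 1.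
Proof.
have /andP[/ltW b0 /ltW b1] := beta01.
rewrite /separation_pow.
case: separation_time => [k|]; last by rewrite lexx ler01.
by rewrite exprn_ge0// exprn_ile1.
Qed.

(** If the first returns agree and the later ones are shifted by one, the
separation time increases by 1; the convention [beta ^ oo = 0] is
compatible with this. *)
Lemma separation_pow_shift (p q p' q' : point) :
  separated_at T x0 p'.1 q'.1 0 = false ->
  (forall k, separated_at T x0 p'.1 q'.1 k.+1 = separated_at T x0 p.1 q.1 k) ->
  separation_pow T x0 beta p' q' = beta * separation_pow T x0 beta p q.
Proof.
move=> s0 sS; rewrite /separation_pow /separation_time.
case: pselect => [ex'|nex']; case: pselect => [ex|nex].
- case: ex_minnP => k sk mink; case: ex_minnP => j sj minj.
  case: k sk mink => [|k]; first by rewrite s0.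
  rewrite sS => sk mink; rewrite exprS; congr (_ * _ ^+ _).
  by apply/eqP; rewrite eqn_leq minj// andbT -ltnS mink// sS.
- by exfalso; case: ex' => -[|k]; rewrite ?s0 ?sS// => sk; apply: nex; exists k.
- by exfalso; case: ex => k; rewrite -sS => sk; apply: nex'; exists k.+1.
- by rewrite mulr0.
Qed.

End separation.

Section perron_frobenius_value.
Context (R : realType) (x0 : R) (T : R -> R).
Local Notation point := (measurableTypeR R * nat)%type.
Variable JF : point -> R.

(** The fibre of the tower map is countable in general; only the points where
[f] does not vanish matter, and for a density that is 0 on the hole there
are finitely many. *)
Lemma perron_frobenius_finite (f : point -> R) p m (F : nat -> point) :
  (forall q, 0 <= f q) ->
  (forall k, (k < m)%N -> tower T x0 (F k) /\ tower_map T x0 (F k) = p) ->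
  {in `I_m &, injective F} ->
  (forall q, tower T x0 q -> tower_map T x0 q = p -> f q != 0 ->
    exists2 k, (k < m)%N & q = F k) ->
  perron_frobenius T x0 JF f p = \sum_(k < m) f (F k) / `|JF (F k)|.
Proof.
move=> f0 Ffib Finj Fsurj.
pose fibre : set point := [set q | tower T x0 q /\ tower_map T x0 q = p].
pose w (q : point) := (f q / `|JF q|)%:E.
change (fine (\esum_(q in fibre) (w^\+)%E q - \esum_(q in fibre) (w^\-)%E q)%E
  = \sum_(k < m) f (F k) / `|JF (F k)|).
have w0 q : (0 <= w q)%E by rewrite /w lee_fin divr_ge0.
rewrite [X in (_ - X)%E]esum1; last first.
  move=> q _; rewrite funenegE; apply/max_idPr.
  by rewrite leeNl oppe0; exact: w0.
rewrite sube0 (@eq_esum _ _ _ _ w); last first.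
  by move=> q _; rewrite funeposE; apply/max_idPl; exact: w0.
rewrite (esumID (F @` `I_m))//.
rewrite [X in (_ + X)%E]esum1; last first.
  move=> q [[tq Tq] NFq]; rewrite /w; have [->|fq] := eqVneq (f q) 0.
    by rewrite mul0r.
  by have [k km qk] := Fsurj _ tq Tq fq; exfalso; apply: NFq; exists k.
rewrite adde0 (_ : fibre `&` _ = F @` `I_m); last first.
  apply/seteqP; split => [q []//|q Fq]; split => //.
  by case: Fq => k /= /Ffib [? ?] <-.
rewrite esum_image// esum_fset//.
by rewrite -fsbig_ord sumEFin.
Qed.

End perron_frobenius_value.

Section fixed_density.
Context (R : realType) (alpha x0 : R) (T : R -> R).
Context (JF : measurableTypeR R * nat -> R) (beta c C : R).
Hypothesis pm : pomeau_manneville alpha x0 T.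
Hypothesis jacJF : is_jacobian T x0 JF.
Hypothesis beta01 : 0 < beta < 1.
Hypothesis dist : jacobian_distortion T x0 JF beta c.
Hypothesis C_gt0 : 0 < C.
Hypothesis cC : c / (1 - beta) <= C.
Context (n : nat).
Hypothesis n_gt0 : (1 <= n)%N.
Local Notation point := (measurableTypeR R * nat)%type.
Local Notation G := (regular_points x0 T).
Local Notation y := (return_branch x0 T).
Local Notation B := (fun x x' : measurableTypeR R =>
  separation_pow T x0 beta (x, 0%N) (x', 0%N)).
Let w (k : nat) (z : measurableTypeR R) : R := (JF (y k z, k))^-1.

Lemma branch_cell k z : G z -> cell T x0 k k.+1 (y k z, k).
Proof.
move=> /regular_points_itv zx; have [bq rt _] := return_branchP pm k zx.
by split.
Qed.

Lemma branch_tower k z : G z -> tower T x0 (y k z, k).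
Proof. by move=> Gz; apply: (cell_tower (branch_cell k Gz)). Qed.

Lemma separation_return_branch k z z' : G z -> G z' ->
  B (y k z) (y k z') = beta * B z z'.
Proof.
move=> Gz Gz'; apply: separation_pow_shift => [|j] /=.
  apply/negbTE; rewrite negbK; apply/asboolP; exists k.+1.
  by split => //; [have [] := branch_cell k Gz|have [] := branch_cell k Gz'].
rewrite /separated_at !iterSr.
by rewrite !(return_map_branch pm).
Qed.

(** The tower map sends the top of the column over [y k z] to [z], so the
distortion bound for the Jacobian is expressed by the separation time of
[z] and [z']. *)
Lemma weight_distortion k z z' : G z -> G z' ->
  w k z <= w k z' * expR (c * B z z').
Proof.
move=> Gz Gz'; have [_ J0 _] := jacJF.
have Jz := J0 _ (branch_tower k Gz); have Jz' := J0 _ (branch_tower k Gz').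
have := dist (branch_cell k Gz') (branch_cell k Gz).
have FE u : G u -> tower_map T x0 (y k u, k) = (u, 0%N).
  move=> Gu; have [_] := tower_mapP pm (y k u, k) Gu.
  by move=> /(_ (ex_intro _ k erefl)) [].
rewrite !FE// separation_powC ger0_norm; last by rewrite divr_ge0 ?ltW.
by rewrite /w ler_pdivlMl.
Qed.

Lemma measurable_weight k : measurable_fun G (w k).
Proof.
have [mJ J0 _] := jacJF.
have mb : measurable_fun G (fun z : measurableTypeR R => (y k z, k) : point).
  apply: measurable_funTS; apply: measurable_fun_pair => //.
  exact: (measurable_return_branch pm).
have mJy : measurable_fun G (fun z : measurableTypeR R => JF (y k z, k)).
  apply: (measurable_comp _ _ mJ mb); first exact: (measurable_tower pm).
  by move=> _ [z Gz <-]; exact: branch_tower.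
apply: (eq_measurable_fun (fun z : measurableTypeR R => JF (y k z, k) `^ (-1))).
  move=> z; rewrite inE => Gz; rewrite powR_inv1// ltW// J0//.
  exact: branch_tower.
exact: (measurableT_comp (measurable_powR (-1)) mJy).
Qed.

(** The base system satisfies the hypotheses of [exists_fixed_density]; the
condition on [C] is [c + beta * C <= C]. *)
Lemma exists_base_density : exists t (h : measurableTypeR R -> R),
  [/\ 0 < t, measurable_fun G h, forall x, G x -> 0 < h x,
    log_regular G B C h &
    forall x, G x -> transfer n y w t h x = h x].
Proof.
have /andP[b0 b1] := beta01.
have [_ J0 _] := jacJF.
apply: (@exists_fixed_density _ (measurableTypeR R) R G n y w B beta c C).
- exact: measurable_regular_points.
- exact: n_gt0.
- by move=> k z; exact: (regular_return_branch pm).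
- by move=> k; apply: measurable_funTS; exact: (measurable_return_branch pm).
- exact: measurable_weight.
- by move=> k z Gz; rewrite invr_gt0 J0//; exact: branch_tower.
- by move=> x x'; exact: separation_pow_itv.
- by move=> k z z' Gz Gz'; rewrite separation_return_branch.
- exact: weight_distortion.
- exact: ltW.
- by move: cC; rewrite ler_pdivrMr ?subr_gt0//; lra.
- exact: (regular_points_nonempty pm).
Qed.

End fixed_density.

(** * The invariant density on the tower *)

#[local] Instance tower_ae_filter (R : realType) :
  Filter (nbhs (almost_everywhere (@tower_measure R))) :=
  ae_filter_ringOfSetsType (@tower_measure R).

Section tower_density.
Context (R : realType) (alpha x0 : R) (T : R -> R).
Context (JF : measurableTypeR R * nat -> R) (beta C : R) (n : nat).
Hypothesis pm : pomeau_manneville alpha x0 T.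
Hypothesis jacJF : is_jacobian T x0 JF.
Hypothesis beta01 : 0 < beta < 1.
Hypothesis n_gt0 : (1 <= n)%N.
Local Notation point := (measurableTypeR R * nat)%type.
Local Notation nu := (@tower_measure R).
Local Notation leb := (@lebesgue_measure R).
Local Notation G := (regular_points x0 T).
Local Notation y := (return_branch x0 T).
Local Notation B := (fun x x' : measurableTypeR R =>
  separation_pow T x0 beta (x, 0%N) (x', 0%N)).
Local Notation w :=
  (fun (k : nat) (z : measurableTypeR R) => (JF (y k z, k))^-1).
Local Notation tower := (tower T x0).
Local Notation hole := (hole T x0 n).
Let x0_gt0 : 0 < x0. Proof. by have /andP[] := pm_x0 pm. Qed.
Let x0_lt1 : x0 < 1. Proof. by have /andP[] := pm_x0 pm. Qed.
Context (t : R) (h : measurableTypeR R -> R).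
Hypothesis t_gt0 : 0 < t.
Hypothesis mh : measurable_fun G h.
Hypothesis h_gt0 : forall x, G x -> 0 < h x.
Hypothesis h_reg : log_regular G B C h.
Hypothesis h_fixed : forall x, G x -> transfer n y w t h x = h x.
Hypothesis C_ge0 : 0 <= C.

(** Each step up the tower multiplies the density by the inverse eigenvalue
[t]; the function is extended by 0 over the singular base points. *)
Definition tower_density (p : point) : R :=
  \1_(~` hole) p * (t ^+ p.2 * (h \_ G) p.1).

Lemma tower_density_out p : ~ hole p -> G p.1 ->
  tower_density p = t ^+ p.2 * h p.1.
Proof.
by move=> Np Gp; rewrite /tower_density indicE !mem_set// mul1r patchE mem_set.
Qed.

Lemma tower_density_hole p : hole p -> tower_density p = 0.
Proof.
by move=> hp; rewrite /tower_density indicE memNset ?mul0r// => /(_ hp).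
Qed.

Lemma tower_density_ge0 p : 0 <= tower_density p.
Proof.
rewrite mulr_ge0// mulr_ge0 ?exprn_ge0 ?(ltW t_gt0)// patchE.
by case: ifPn => // /set_mem /h_gt0 /ltW.
Qed.

Lemma measurable_tower_density : measurable_fun setT tower_density.
Proof.
have mhole := measurable_hole pm n.
apply: measurable_funM; first exact: measurable_indic (measurableC mhole).
apply: measurable_funM.
  by apply: (measurableT_comp (f := fun k : nat => t ^+ k)).
apply: (measurableT_comp (f := h \_ G)) => //.
by apply/(measurable_restrictT _ (measurable_regular_points x0 T)).
Qed.

(** Points in one cell lie on the same level and are both in the hole or both
off it, so the powers of [t] cancel and only the regularity of [h] remains. *)
Lemma tower_density_regular p q : G p.1 -> G q.1 ->
  comparable_points T x0 p q ->
  tower_density p <= tower_density q * expR (C * separation_pow T x0 beta p q).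
Proof.
case: p q => [x l] [x' l'] /= Gx Gx'.
have key : l = l' -> (hole (x, l) <-> hole (x', l')) ->
    tower_density (x, l) <=
    tower_density (x', l') *
      expR (C * separation_pow T x0 beta (x, l) (x', l')).
  move=> <- hh; have [/[dup] hx /hh hx'|Nx] := pselect (hole (x, l)).
    by rewrite !tower_density_hole// mul0r.
  rewrite !tower_density_out//=; last by move=> /hh.
  by rewrite -mulrA ler_wpM2l ?exprn_ge0 ?(ltW t_gt0)//; exact: h_reg.
move=> [[k [i [cp cq]]]|[[_ /= l0] [_ /= l0']]]; apply: key.
- by case: cp => _ /= -> _; case: cq => _ /= -> _.
- by rewrite (hole_cell n cp) (hole_cell n cq).
- by rewrite l0.
- by rewrite l0 l0'; split=> /hole_ground.
Qed.

(** On the base this is the fixed point equation of [h], the columns of height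
larger than [n] being cut off by the hole; on higher levels the operator
only translates upwards. *)
Lemma conditional_operator_density (a : R) p : 0 <= a -> tower p -> G p.1 ->
  (forall l, (l.+1 < return_time T x0 p.1)%N -> JF (p.1, l) = 1) ->
  conditional_operator T x0 JF n (fun q => a * tower_density q) p =
  t^-1 * (a * tower_density p).
Proof.
move=> a0 tp Gp J1; rewrite /conditional_operator.
have [hp|Np] := pselect (hole p).
  rewrite tower_density_hole// !mulr0 indicE memNset ?mul0r//.
  by move=> [_ /(_ hp)].
rewrite indicE mem_set ?mul1r//.
have t0 : t != 0 by rewrite gt_eqF.
have f0 q : 0 <= a * tower_density q * \1_(tower `\` hole) q.
  by rewrite mulr_ge0// mulr_ge0// tower_density_ge0.
have indic1 q : tower q -> ~ hole q -> \1_(tower `\` hole) q = 1 :> R.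
  by move=> tq Nq; rewrite indicE mem_set.
have [_ J0 _] := jacJF.
case: p Gp tp J1 Np => z [|l] /= Gz tp J1 Np.
- have hk k : hole (y k z, k) <-> (0 < k)%N /\ (n < k.+1)%N.
    exact: (hole_cell n (branch_cell pm k Gz)).
  rewrite (@perron_frobenius_finite _ _ _ _ _ _ n (fun k => (y k z, k))) //.
  + rewrite tower_density_out//= expr0 mul1r -[in RHS](h_fixed Gz) /transfer.
    rewrite !mulr_sumr; apply: eq_bigr => -[k kn] _ /=.
    have Nk : ~ hole (y k z, k) by move=> /hk [_]; rewrite ltnS leqNgt kn.
    have tk := branch_tower pm k Gz.
    rewrite indic1// mulr1 tower_density_out//=; last first.
      exact: (regular_return_branch pm).
    rewrite (gtr0_norm (J0 _ tk)) exprS.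
    have Jk0 : JF (y k z, k) != 0 by rewrite gt_eqF// J0.
    by field; rewrite Jk0 t0.
  + move=> k kn; have [_] := tower_mapP pm (y k z, k) Gz.
    by move=> /(_ (ex_intro _ k erefl)) [].
  + by move=> k k' _ _ [].
  + move=> q tq Tq; have [/(_ (conj tq Tq)) [k ->] _] := tower_mapP pm q Gz.
    have [kn _|nk] := ltnP k n; first by exists k.
    rewrite indicE memNset ?mulr0 ?eqxx// => -[_ Nk]; apply: Nk; apply/hk.
    by split=> //; exact: leq_trans nk.
- have lR : (l.+1 < return_time T x0 z)%N by case: tp.
  have tl : tower (z, l) by case: tp => bz _; split => //=; exact: ltnW.
  have Nl : ~ hole (z, l).
    move=> /(hole_cell n (tower_cell tl)) [_ nR]; apply: Np.
    by apply/(hole_cell n (tower_cell tp)).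
  rewrite (@perron_frobenius_finite _ _ _ _ _ _ 1 (fun=> (z, l))) //.
  + rewrite big_ord_recl big_ord0 addr0 indic1// J1// normr1 mulr1 divr1.
    rewrite !tower_density_out//= exprS.
    by field.
  + by move=> k _; split => //; rewrite /tower_map/= lR.
  + by move=> k k'; rewrite !inE /= !ltnS !leqn0 => /eqP -> /eqP ->.
  + move=> [x k] tq + _; rewrite /tower_map/=; case: ifP => // _ [-> ->].
    by exists 0%N.
Qed.

Lemma ae_regular_base : {ae nu, forall p, base x0 p.1 -> G p.1}.
Proof.
have : leb.-negligible (singular_orbits x0 T).
  have cS := countable_singular_orbits x0 T.
  apply/negligibleP; last exact: countable_lebesgue_measure0.
  by apply: countable_measurable cS => x; exact: measurable_set1.
move=> /negligible_columns; apply: negligibleS => p /=.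
apply: contra_notP => Np bp.
have Nsing a : a \in [:: 0; x0; 1] -> p.1 != a.
  by move=> ha; apply/eqP => pa; apply: Np; exists 0%N => //; exists a.
split=> //; move: bp; rewrite /base /= !in_itv/= => /andP[h1 h2].
by rewrite !lt_neqAle h1 h2 !andbT eq_sym !Nsing// !inE eqxx ?orbT.
Qed.

Lemma ae_jacobian_eq1 : {ae nu, forall p, tower p ->
  forall l, (l.+1 < return_time T x0 p.1)%N -> JF (p.1, l) = 1}.
Proof.
have := jacobian_eq1 pm jacJF => /negligible_columns.
by apply: negligibleS => p /=; apply: contra_not => hp [bp _]; exact: hp.
Qed.

Lemma integral_off_hole :
  (\int[nu]_(p in tower `\` hole) (tower_density p)%:E =
   \int[nu]_(p in tower) (tower_density p)%:E)%E.
Proof.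
rewrite integral_mkcond [RHS]integral_mkcond; apply: eq_integral => p _.
rewrite !patchE; have [tp|tp] := pselect (tower p); last first.
  by rewrite [p \in tower]memNset// memNset// => -[/tp].
rewrite [p \in tower]mem_set//; have [hp|Np] := pselect (hole p).
  by rewrite memNset ?tower_density_hole// => -[_ /(_ hp)].
by rewrite mem_set.
Qed.

(** Off the hole only the levels below [n] of the tower remain, and [h] is
bounded on the regular points by bounded distortion. *)
Lemma integral_tower_density_lty :
  (\int[nu]_(p in tower) (tower_density p)%:E < +oo)%E.
Proof.
have [z0 Gz0] := regular_points_nonempty pm.
(* a sum over the levels bounds each level without comparing [t] with 1 *)
pose M := \sum_(l < n) t ^+ l * (expR C * h z0).
have M0 : 0 <= M.
  apply: sumr_ge0 => l _; rewrite mulr_ge0 ?exprn_ge0 ?(ltW t_gt0)//.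
  by rewrite mulr_ge0 ?expR_ge0// ltW// h_gt0.
pose D : set point := base x0 `*` `I_n.
have mD : measurable D by apply: measurableX => //; exact: measurable_base.
rewrite -integral_off_hole.
have tD p : (tower `\` hole) p -> D p.
  move=> [tp Np]; split; first by case: tp.
  rewrite /= ltnNge; apply/negP => np; apply: Np.
  apply/(hole_cell n (tower_cell tp)); split; first exact: leq_trans np.
  by case: tp => _; exact: leq_ltn_trans.
apply: (@le_lt_trans _ _ (\int[nu]_(p in D) M%:E)%E).
  rewrite integral_mkcond [leRHS]integral_mkcond.
  have pos (A : set point) (k : point -> \bar R) : (forall p, 0 <= k p)%E ->
      forall p, (0 <= (k \_ A) p)%E.
    by move=> k0 p; rewrite patchE; case: ifP.
  apply: ge0_ae_le_integral.
  - by apply: pos => p; rewrite lee_fin tower_density_ge0.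
  - by apply: pos => p; rewrite lee_fin.
  apply: aeW => p _; rewrite !patchE; case: ifPn => [|_]; last by case: ifP.
  rewrite inE => thp; rewrite mem_set; last exact: tD.
  rewrite lee_fin; have [Gp|NG] := pselect (G p.1); last first.
    by rewrite /tower_density patchE memNset// mulr0 mulr0.
  rewrite tower_density_out//; last by case: thp.
  have [_ /= ln] := tD _ thp.
  rewrite /M (bigD1 (Ordinal ln))//= -[leLHS]addr0 lerD//.
    rewrite ler_wpM2l ?exprn_ge0 ?(ltW t_gt0)//.
    apply: (log_regular_le (B := B) (C := C)) h_reg Gp Gz0 => //.
    - by move=> x x'; exact: separation_pow_itv.
    - by move=> x /h_gt0 /ltW.
  apply: sumr_ge0 => l _; rewrite mulr_ge0 ?exprn_ge0 ?(ltW t_gt0)//.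
  by rewrite mulr_ge0 ?expR_ge0// ltW// h_gt0.
rewrite integral_cst//; apply: lte_mul_pinfty => //.
rewrite /= /tower_measure /D product_measure1E//; last exact: measurable_base.
rewrite /= /counting asboolT; last exact: finite_II.
apply: lte_mul_pinfty => //; last exact: ltry.
by rewrite /base lebesgue_measure_itv/= lte_fin x0_lt1.
Qed.

(** The points of the right branch that return at once form an interval of
positive length, and [h] is bounded below by bounded distortion. *)
Lemma integral_tower_density_gt0 :
  (0 < \int[nu]_(p in tower) (tower_density p)%:E)%E.
Proof.
have [z0 Gz0] := regular_points_nonempty pm.
pose b := h z0 / expR C.
have b0 : 0 < b by rewrite divr_gt0 ?h_gt0 ?expR_gt0.
(* points to the right of [a] are mapped by [T] to the right of [x0] *)
pose a := branch_inverse T x0 1 x0.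
have [/andP[xa a1] Ta] : x0 < a < 1 /\ T a = x0.
  by apply: (phi1P pm); rewrite x0_gt0.
pose D : set point := `]a, 1[ `*` [set 0%N].
have mD : measurable D by apply: measurableX => //; exact: measurable_itv.
have DT p : D p -> tower p.
  move=> [/= + p0]; rewrite in_itv/= => /andP[ap p1].
  have bp : base x0 p.1.
    by rewrite /base /= in_itv/= (ltW p1) (ltW (lt_trans xa ap)).
  have Tp : x0 < T p.1 < 1.
    rewrite -[X in X < _]Ta; apply/andP; split.
      apply: (derive_gt1_increasing (pm_right_derivable pm)) => //.
      exact: pm_expanding_right pm.
    have [fT _ _] := pm_branch_right pm.
    have := fT p.1; rewrite /= !in_itv/= p1 (lt_trans xa ap) => /(_ isT).
    by move=> /andP[].
  have -> : p = (p.1, 0%N) by case: p p0 {ap p1 bp Tp} => ? ? /= ->.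
  split=> //=; have /return_timeP -> // : returns_at T x0 p.1 1 /\
      forall j, (j <= 0)%N -> ~~ returns_at T x0 p.1 j.
  by split=> // -[].
have lebD : nu D = (1 - a)%:E.
  rewrite tower_measure_level; last exact: measurable_itv.
  by rewrite lebesgue_measure_itv/= lte_fin a1 EFinD.
have : (0 < \int[nu]_(p in D) b%:E)%E.
  rewrite integral_cst// [X in (_ * X)%E]lebD -EFinM lte_fin.
  by rewrite mulr_gt0// subr_gt0.
move=> /lt_le_trans; apply.
apply: (@le_trans _ _ (\int[nu]_(p in D) (tower_density p)%:E)%E).
  apply: ge0_ae_le_integral.
  - by move=> p; rewrite lee_fin ltW.
  - by move=> p; rewrite lee_fin tower_density_ge0.
  move: ae_regular_base; apply: filterS => p GP Dp; have Gp := GP (DT _ Dp).1.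
  have p0 : p.2 = 0%N by case: Dp.
  rewrite lee_fin tower_density_out//; last first.
    by case: p p0 {GP Dp Gp} => x l /= ->; exact: hole_ground.
  rewrite p0 expr0 mul1r /b ler_pdivrMr ?expR_gt0// mulrC.
  apply: (log_regular_le (B := B) (C := C)) h_reg Gz0 Gp => //.
  - by move=> x x'; exact: separation_pow_itv.
  - by move=> x /h_gt0 /ltW.
apply: ge0_subset_integral => //; first exact: (measurable_tower pm).
- apply/measurable_EFinP; exact: measurable_funTS measurable_tower_density.
- by move=> p _; rewrite lee_fin tower_density_ge0.
Qed.

End tower_density.

Theorem theorem4p2 (R : realType) (alpha x0 : R) (T : R -> R)
    (JF : measurableTypeR R * nat -> R) (beta c C : R) :
  pomeau_manneville alpha x0 T ->
  nonsingular T x0 ->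
  is_jacobian T x0 JF ->
  0 < beta < 1 ->
  jacobian_distortion T x0 JF beta c ->
  0 < C ->
  c / (1 - beta) <= C ->
  forall n : nat, (1 <= n)%N ->
    exists f : measurableTypeR R * nat -> R,
      cone T x0 beta C n f /\
      normalised_operator T x0 JF n f = f %[ae tower_measure in tower T x0].
Proof.
move=> pm _ jac b01 dist C0 cC n n0.
have [t [h [t0 mh h0 h_reg h_fix]]] :=
  exists_base_density pm jac b01 dist C0 cC n0.
pose f0 := tower_density x0 T n t h.
pose I0 := fine (\int[tower_measure]_(p in tower T x0) (f0 p)%:E)%E.
have mtow := measurable_tower pm.
have f0_ge0 p : 0 <= f0 p by exact: tower_density_ge0.
have mf0 : measurable_fun setT f0.
  exact: (measurable_tower_density n pm t mh).
have I0E : (\int[tower_measure]_(p in tower T x0) (f0 p)%:E = I0%:E)%E.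
  rewrite fineK// ge0_fin_numE.
    exact: (integral_tower_density_lty pm b01 n0 t0 h0 h_reg (ltW C0)).
  by apply: integral_ge0 => p _; rewrite lee_fin.
have I0_gt0 : 0 < I0.
  rewrite -lte_fin -I0E.
  exact: (integral_tower_density_gt0 n pm b01 t0 mh h0 h_reg (ltW C0)).
pose f p := I0^-1 * f0 p.
have f_ge0 p : 0 <= f p by rewrite mulr_ge0 ?invr_ge0 ?(ltW I0_gt0).
have mf : measurable_fun setT f by exact: measurable_funM.
have f_int : (\int[tower_measure]_(p in tower T x0) (f p)%:E = 1)%E.
  under eq_integral do rewrite EFinM.
  rewrite ge0_integralZl//.
  - by rewrite I0E -EFinM mulVf// gt_eqF.
  - by apply/measurable_EFinP; exact: measurable_funTS.
  - by move=> p _; rewrite lee_fin.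
  - by rewrite lee_fin invr_ge0 ltW.
have reg := @ae_regular_base R x0 T.
exists f; split; [split; [split|..]|].
- apply/integrableP; split.
    by apply/measurable_EFinP; exact: measurable_funTS.
  under eq_integral do rewrite /= ger0_norm//.
  by rewrite f_int ltry.
- by apply: aeW => p _.
- have := negligible_pairs reg; apply: negligibleS => pq /=.
  apply: contra_notP => /not_orP[/contrapT Gp /contrapT Gq] cpq.
  rewrite -mulrA ler_wpM2l ?invr_ge0 ?(ltW I0_gt0)//.
  apply: (tower_density_regular n t0 h_reg); last exact: cpq.
    apply: Gp; by case: cpq => [[l [i [[[]]]]]|[[]]].
  apply: Gq; by case: cpq => [[l [i [_ [[]]]]]|[_ []]].
- under eq_integral do rewrite EFinM.
  rewrite ge0_integralZl//.
  + by rewrite integral_off_hole I0E -EFinM mulVf// gt_eqF.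
  + apply: measurableD => //; exact: (measurable_hole pm).
  + by apply/measurable_EFinP; exact: measurable_funTS.
  + by move=> p _; rewrite lee_fin.
  + by rewrite lee_fin invr_ge0 ltW.
- by apply: aeW => p hp; rewrite /f /f0 tower_density_hole// mulr0.
- have fix_ae : {ae @tower_measure R, forall p, tower T x0 p ->
      conditional_operator T x0 JF n f p = t^-1 * f p}.
    apply: filterS2 reg (ae_jacobian_eq1 pm jac) => p Gp J1 tp.
    apply: (conditional_operator_density pm jac n0 t0 h0 h_fix).
    - by rewrite invr_ge0 ltW.
    - exact: tp.
    - by apply: Gp; case: tp.
    - exact: J1.
  (* [f] has integral 1, so its image has norm [t^-1] *)
  have -> : normalised_operator T x0 JF n f =
      fun p => conditional_operator T x0 JF n f p / t^-1.
    apply/funext => p; rewrite /normalised_operator; congr (_ / _).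
    rewrite /L1norm /Rintegral.
    rewrite (@ge0_ae_eq_integral_nonmeasurable _ _ _ _ _ _
      (fun p => (t^-1 * f p)%:E)).
    - under eq_integral do rewrite EFinM.
      rewrite ge0_integralZl//.
      + by rewrite f_int mule1.
      + by apply/measurable_EFinP; exact: measurable_funTS.
      + by move=> q _; rewrite lee_fin.
      + by rewrite lee_fin invr_ge0 ltW.
    - by move=> q; rewrite lee_fin.
    - by move=> q; rewrite lee_fin mulr_ge0// invr_ge0 ltW.
    - apply: filterS fix_ae => q fq tq.
      by rewrite fq// ger0_norm// mulr_ge0// invr_ge0 ltW.
  apply: filterS fix_ae => p fp tp.
  by rewrite fp// mulrAC divff ?mul1r// invr_neq0// gt_eqF.
Qed.
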